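(* Let $M$ be a matroid and let $M'$ be a matroidal retract of $M$. Then $\mathbb{K}[\mathrm{Cyc}(M')]$ is an algebra retract of $\mathbb{K}[\mathrm{Cyc}(M)]$.
   Context: Throughout, matroids are finite and non-free (they have at least one circuit). $\mathbb{K}$ is a field. A cycle of a matroid $M$ is a disjoint union of (possibly zero) circuits; $\mathrm{Cyc}(M)$ is the set of cycles; $\chi_C\in\{0,1\}^{E(M)}$ is the characteristic vector of $C$. The cycle algebra is $\mathbb{K}[\mathrm{Cyc}(M)]=\mathbb{K}[\mathbf{y}^C z: C\in\mathrm{Cyc}(M)]\subseteq\mathbb{K}[y_e,z: e\in E(M)]$, $\mathbf{y}^C=\prod_{e\in C}y_e$, standard graded by $\deg z=1$, $\deg y_e=0$. Matroidal retract: for matroids $M,M'$ with $E(M')\subseteq E(M)$, $M'$ is a matroidal retract of $M$ if there exist maps $\lambda:\mathrm{Cyc}(M')\to\mathrm{Cyc}(M)$ and $\pi:\mathrm{Cyc}(M)\to\mathrm{Cyc}(M')$ such that (a) $\pi\circ\lambda=\mathrm{id}_{\mathrm{Cyc}(M')}$; (b) whenever $\sum_{i=1}^d\chi_{C'_i}=\sum_{i=1}^d\chi_{D'_i}$ for $C'_i,D'_i\in\mathrm{Cyc}(M')$, $d\ge1$, then $\sum_{i=1}^d\chi_{\lambda(C'_i)}=\sum_{i=1}^d\chi_{\lambda(D'_i)}$; (c) whenever $\sum_{i=1}^d\chi_{C_i}=\sum_{i=1}^d\chi_{D_i}$ for $C_i,D_i\in\mathrm{Cyc}(M)$, $d\ge1$,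 then $\sum_{i=1}^d\chi_{\pi(C_i)}=\sum_{i=1}^d\chi_{\pi(D_i)}$. For graded $\mathbb{K}$-algebras $A,B$, $A$ is an algebra retract of $B$ if there are homogeneous $\mathbb{K}$-algebra homomorphisms (not necessarily of degree $0$) $\iota:A\to B$, $\gamma:B\to A$ with $\gamma\circ\iota=\mathrm{id}_A$. *)

(* Defs.v *)
From HB Require Import structures.
From mathcomp Require Import all_boot all_order all_algebra.
From mathcomp Require Import boolp.
From mathcomp Require Import mpoly.

Set Implicit Arguments.
Unset Strict Implicit.
Unset Printing Implicit Defensive.

Import GRing.Theory.
Local Open Scope ring_scope.

(* Finite matroids whose ground set is a subset of a fixed finite type, so that
   E(M') can be compared with E(M). *)
Record matroid (T : finType) := Matroid {
  ground : {set T};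
  indep : {set {set T}};
  indep_ground : forall I : {set T}, I \in indep -> I \subset ground;
  indep_set0 : set0 \in indep;
  indep_sub : forall I J : {set T}, J \in indep -> I \subset J -> I \in indep;
  indep_aug : forall I J : {set T}, I \in indep -> J \in indep -> (#|I| < #|J|)%N ->
    exists2 e, e \in J :\: I & e |: I \in indep
}.

Section Matroids.
Variables (T : finType) (M : matroid T).

Definition elt : finType := {e : T | e \in ground M}.

Definition circuit (C : {set T}) : bool :=
  minset [pred D : {set T} | (D \subset ground M) && (D \notin indep M)] C.

Definition nonfree : Prop := exists C, circuit C.

Definition is_cycle (C : {set T}) : bool :=
  [exists P : {set {set T}},
    [&& [forall D in P, circuit D], trivIset P & cover P == C]].

Definition Cyc : finType := {C : {set T} | is_cycle C}.

Definition chi (C : Cyc) : {ffun elt -> int} :=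
  [ffun e => (val e \in val C)%:R].

End Matroids.

Definition preserves_chi (T T' : finType) (M : matroid T) (M' : matroid T')
    (f : Cyc M -> Cyc M') : Prop :=
  forall (d : nat) (C D : 'I_d -> Cyc M), (0 < d)%N ->
    \sum_(i < d) chi (C i) = \sum_(i < d) chi (D i) ->
    \sum_(i < d) chi (f (C i)) = \sum_(i < d) chi (f (D i)).

Definition matroidal_retract (T : finType) (M' M : matroid T) : Prop :=
  ground M' \subset ground M /\
  exists (lambda : Cyc M' -> Cyc M) (pi : Cyc M -> Cyc M'),
    [/\ cancel lambda pi, preserves_chi lambda & preserves_chi pi].

Section GeneratedSubalgebra.
Variables (K : fieldType) (A : algType K) (S : A -> Prop).

Definition subalg_gen : {pred A} := fun p =>
  `[< forall B : {pred A},
        GRing.subalg_closed B -> (forall x, S x -> x \in B) -> p \in B >].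

Fact subalg_gen_closed : GRing.subalg_closed subalg_gen.
Proof.
split=> [|a u v|u v].
- by apply/asboolP => B [].
- move=> /asboolP hu /asboolP hv; apply/asboolP => B cB sB.
  by case: (cB) => _ linB _; apply: linB; [apply: hu | apply: hv].
- move=> /asboolP hu /asboolP hv; apply/asboolP => B cB sB.
  by case: (cB) => _ _ mulB; apply: mulB; [apply: hu | apply: hv].
Qed.

HB.instance Definition _ :=
  GRing.isSubalgClosed.Build K A subalg_gen subalg_gen_closed.

End GeneratedSubalgebra.

Section CycleAlgebra.
Variables (K : fieldType) (T : finType) (M : matroid T).

(* K[y_e, z : e in E(M)]: index 0 is z, the other indices enumerate E(M). *)
Definition yzpoly := {mpoly K[#|elt M|.+1]}.

Definition zvar : yzpoly := 'X_ord0.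
Definition yvar (e : elt M) : yzpoly := 'X_(lift ord0 (enum_rank e)).

Definition cyc_gen (C : Cyc M) : yzpoly :=
  (\prod_(e : elt M | val e \in val C) yvar e) * zvar.

Definition cycle_alg_pred : {pred {mpoly K[#|elt M|.+1]}} :=
  subalg_gen (fun p => exists C : Cyc M, p = cyc_gen C).
HB.instance Definition _ := GRing.SubalgClosed.on cycle_alg_pred.

Record cycle_algebra := CycleAlgebra {
  cycle_alg_val :> {mpoly K[#|elt M|.+1]};
  _ : cycle_alg_val \in cycle_alg_pred
}.

HB.instance Definition _ := [isSub for cycle_alg_val].
HB.instance Definition _ := [Choice of cycle_algebra by <:].
HB.instance Definition _ := [SubChoice_isSubAlgebra of cycle_algebra by <:].
HB.instance Definition _ :=
  [SubNzRing_isSubComNzRing of cycle_algebra by <:].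

(* deg z = 1, deg y_e = 0. *)
Definition cycle_component (i : int) (p : cycle_algebra) : Prop :=
  forall m, m \in msupp (val p) -> (m ord0)%:Z = i.

End CycleAlgebra.

(* f(A_i) is contained in B_(i + d) for some degree shift d.  When A and B are
   generated in degree 1 and A_1 <> 0, asking instead that homogeneous elements
   go to homogeneous elements yields the same algebra retracts, since the two
   maps compose to the identity. *)
Definition homogeneous_map (A B : Type) (gA : int -> A -> Prop)
    (gB : int -> B -> Prop) (f : A -> B) : Prop :=
  exists d : int, forall (i : int) (x : A), gA i x -> gB (i + d) (f x).

(* gA and gB are the Z-graded components of A and B. *)
Definition algebra_retract (K : fieldType) (A B : algType K)
    (gA : int -> A -> Prop) (gB : int -> B -> Prop) : Prop :=
  exists (iota : {lrmorphism A -> B}) (gamma : {lrmorphism B -> A}),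
    [/\ homogeneous_map gA gB iota, homogeneous_map gB gA gamma
      & cancel iota gamma].

(* Main.v *)
Require Import Defs.
From HB Require Import structures.
From mathcomp Require Import all_boot all_order all_algebra.
From mathcomp Require Import boolp.
From mathcomp Require Import mpoly.

(* A cycle algebra is spanned by the monomials that are products of generators,
   and two such products agree exactly when they have the same number of factors
   (the exponent of z) and the same sum of characteristic vectors.  So a map of
   cycles preserving equalities between sums of characteristic vectors induces a
   well-defined map on these monomials.  Its linear extension is multiplicative
   and of degree 0, and depends functorially on the map of cycles. *)

Set Implicit Arguments.
Unset Strict Implicit.
Unset Printing Implicit Defensive.

Import GRing.Theory.
Local Open Scope ring_scope.

Section MonomialLinear.
Variables (K : fieldType) (n k : nat) (w : 'X_{1..n} -> 'X_{1..k}).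

(** The map [w] is arbitrary and need not be additive: a map of cycles determines it only on
    products of generators. Linearity holds regardless. *)
Definition mnm_linear (p : {mpoly K[n]}) : {mpoly K[k]} :=
  \sum_(m <- msupp p) p@_m *: 'X_[w m].

(** Coefficients outside the support vanish. This lets [p], [q] and [a *: p + q] be summed over one
    common list when proving linearity. *)
Lemma mnm_linear_widen r (p : {mpoly K[n]}) :
  uniq r -> {subset msupp p <= r} ->
  mnm_linear p = \sum_(m <- r) p@_m *: 'X_[w m].
Proof.
move=> r_uniq sub_pr; rewrite /mnm_linear.
have eq_supp : perm_eq (msupp p) [seq m <- r | m \in msupp p].
  apply: uniq_perm; rewrite ?msupp_uniq ?filter_uniq // => m.
  by rewrite mem_filter andb_idr //; apply: sub_pr.
by rewrite (perm_big _ eq_supp) big_filter big_rmcond // => m /memN_msupp_eq0 ->; rewrite scale0r.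
Qed.

Fact mnm_linear_is_linear : linear mnm_linear.
Proof.
move=> a p q; pose r := undup (msupp p ++ msupp q).
have sub_r (s : {mpoly K[n]}) : {subset msupp s <= msupp p ++ msupp q} ->
    mnm_linear s = \sum_(m <- r) s@_m *: 'X_[w m].
  by move=> sub_s; apply: mnm_linear_widen => [|m /sub_s]; rewrite ?undup_uniq ?mem_undup.
rewrite !sub_r => [|m mq|m mp|m /msuppD_le]; rewrite ?mem_cat ?mq ?mp ?orbT //.
  rewrite scaler_sumr -big_split /=.
  by apply: eq_bigr => m _; rewrite mcoeffD mcoeffZ scalerDl scalerA.
by case/orP=> [/msuppZ_le|] ->; rewrite ?orbT.
Qed.

HB.instance Definition _ :=
  GRing.isLinear.Build K {mpoly K[n]} {mpoly K[k]} _ mnm_linear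
    mnm_linear_is_linear.

Lemma mnm_linearX (m : 'X_{1..n}) : mnm_linear 'X_[m] = 'X_[w m].
Proof. by rewrite /mnm_linear msuppX big_seq1 mcoeffX eqxx scale1r. Qed.

Lemma msupp_mnm_linear p m :
  m \in msupp (mnm_linear p) -> exists2 m0, m0 \in msupp p & m = w m0.
Proof.
move/msupp_sum_le/flattenP => [r /mapP[m0]]; rewrite filter_predT => pm0 ->.
by move/msuppZ_le; rewrite msuppX inE => /eqP ->; exists m0.
Qed.

(** Additivity of [w] is asked only on the two supports, since nothing is known about [w] away from
    products of generators. *)
Lemma mnm_linearM p q :
  (forall m m', m \in msupp p -> m' \in msupp q -> w (m + m') = (w m + w m')%MM) ->
  mnm_linear (p * q) = mnm_linear p * mnm_linear q.
Proof.
move=> wD; rewrite [p in LHS]mpolyE [q in LHS]mpolyE.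
rewrite mulr_suml linear_sum [RHS]mulr_suml.
apply: eq_big_seq => m pm; rewrite mulr_sumr linear_sum mulr_sumr.
apply: eq_big_seq => m' qm'.
rewrite -!scalerAl -!scalerAr -!mpolyXD !linearZ /=.
by rewrite mnm_linearX wD // !scalerA mulrC.
Qed.

End MonomialLinear.

Section CycleMonomials.
Variables (T : finType) (M : matroid T).

Definition cyc_mnm (C : Cyc M) : 'X_{1..#|elt M|.+1} :=
  (\sum_(e : elt M | val e \in val C) U_(lift ord0 (enum_rank e)) + U_(ord0))%MM.

Definition cycs_mnm (s : seq (Cyc M)) : 'X_{1..#|elt M|.+1} :=
  (\sum_(C <- s) cyc_mnm C)%MM.

Lemma cyc_mnm0 C : cyc_mnm C ord0 = 1%N.
Proof.
rewrite mnmDE mnm_sumE mnm1E eqxx big1 // => e _.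
by rewrite mnm1E.
Qed.

Lemma cyc_mnm_lift C e :
  cyc_mnm C (lift ord0 (enum_rank e)) = (val e \in val C).
Proof.
rewrite mnmDE mnm_sumE mnm1E addn0 big_mkcond /= (bigD1 e) //= mnm1E eqxx.
rewrite big1 ?addn0; first by case: (_ \in _).
move=> e' e'e; rewrite mnm1E (inj_eq lift_inj) (inj_eq enum_rank_inj).
by rewrite (negPf e'e); case: ifP.
Qed.

Lemma cycs_mnm0 s : cycs_mnm s ord0 = size s.
Proof.
rewrite mnm_sumE (eq_bigr (fun=> 1%N)) ?sum1_size // => C _.
exact: cyc_mnm0.
Qed.

Lemma cycs_mnm_lift s e :
  (cycs_mnm s (lift ord0 (enum_rank e)))%:Z = (\sum_(C <- s) chi C) e.
Proof.
rewrite mnm_sumE sum_ffunE -natz raddf_sum /=; apply: eq_bigr => C _.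
by rewrite cyc_mnm_lift ffunE.
Qed.

Lemma cycs_mnm_cat s t : cycs_mnm (s ++ t) = (cycs_mnm s + cycs_mnm t)%MM.
Proof. exact: big_cat. Qed.

Lemma eq_cycs_mnm s t : cycs_mnm s = cycs_mnm t <->
  size s = size t /\ \sum_(C <- s) chi C = \sum_(C <- t) chi C.
Proof.
split=> [eq_st | [eq_size eq_chi]].
  split; first by rewrite -!cycs_mnm0 eq_st.
  by apply/ffunP=> e; rewrite -!cycs_mnm_lift eq_st.
apply/mnmP=> i; case: (unliftP ord0 i) => [j|] ->; last by rewrite !cycs_mnm0.
(* Exponents are naturals but [chi] is integer-valued, so the comparison is made in the integers. *)
by rewrite -[j]enum_valK; apply/eqP; rewrite -eqz_nat !cycs_mnm_lift eq_chi.
Qed.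

Variable K : fieldType.

Lemma mpolyX_cyc_mnm C : 'X_[cyc_mnm C] = cyc_gen K C.
Proof.
rewrite mpolyXD; congr (_ * _).
by rewrite (big_morph (fun m => 'X_[m] : {mpoly K[_]}) (@mpolyXD _ _) (@mpolyX0 _ _)).
Qed.

Lemma mpolyX_cycs_mnm s : 'X_[cycs_mnm s] \in @cycle_alg_pred K T M.
Proof.
rewrite (big_morph (fun m => 'X_[m] : {mpoly K[_]}) (@mpolyXD _ _) (@mpolyX0 _ _)).
apply: rpred_prod => C _; rewrite mpolyX_cyc_mnm.
by apply/asboolP => B _; apply; exists C.
Qed.

(** The polynomials supported on products of generators form a subalgebra [B] containing the
    generators, hence containing the whole cycle algebra. *)
Lemma msupp_cycle_alg p m : p \in @cycle_alg_pred K T M -> m \in msupp p ->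
  exists s, m = cycs_mnm s.
Proof.
pose B := [pred q : {mpoly K[_]} |
  `[< forall m, m \in msupp q -> exists s, m = cycs_mnm s >]].
move=> /asboolP /(_ B) pB; move: m; apply/asboolP/pB; last first.
  move=> _ [C ->]; apply/asboolP => m.
  rewrite -mpolyX_cyc_mnm msuppX inE => /eqP ->.
  by exists [:: C]; rewrite /cycs_mnm big_seq1.
split=> [|a u v|u v].
- apply/asboolP => m; rewrite msupp1 inE => /eqP ->.
  by exists [::]; rewrite /cycs_mnm big_nil.
- move=> /asboolP hu /asboolP hv; apply/asboolP => m /msuppD_le.
  by rewrite mem_cat => /orP[/msuppZ_le|]; [apply: hu | apply: hv].
- move=> /asboolP hu /asboolP hv; apply/asboolP => m.
  move=> /msuppM_le/allpairsP[[m1 m2] /= [/hu[s ->] /hv[t ->] ->]].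
  by exists (s ++ t); rewrite cycs_mnm_cat.
Qed.

End CycleMonomials.

Lemma preserves_chi_cycs_mnm (T T' : finType) (M : matroid T)
    (M' : matroid T') (f : Cyc M -> Cyc M') (s t : seq (Cyc M)) :
  preserves_chi f -> cycs_mnm s = cycs_mnm t ->
  cycs_mnm (map f s) = cycs_mnm (map f t).
Proof.
(* [preserves_chi] covers only families of positive length. If [s] is empty, equality of sizes makes
   [t] empty too. *)
move=> hf /eq_cycs_mnm[]; case: s => [|C0 s]; first by case: t.
set u := C0 :: s => eq_size eq_chi; apply/eq_cycs_mnm; split.
  by rewrite !size_map.
(* Lists become families through [nth]; the default [C0] is never reached, as all indices lie below
   the common size. *)
rewrite !big_map; have:= hf (size u) (nth C0 u) (nth C0 t) isT.
have sum_nth (V : nmodType) (F : Cyc M -> V) v : size u = size v ->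
    \sum_(i < size u) F (nth C0 v i) = \sum_(C <- v) F C.
  by move=> ->; rewrite (big_nth C0) big_mkord.
rewrite !(sum_nth _ (@chi T M)) // !(sum_nth _ (fun C => chi (f C))) //.
by apply.
Qed.

Lemma cycle_mnm_map_exists (T T' : finType) (M : matroid T) (M' : matroid T')
    (f : Cyc M -> Cyc M') : preserves_chi f ->
  exists w : 'X_{1..#|elt M|.+1} -> 'X_{1..#|elt M'|.+1},
    forall s, w (cycs_mnm s) = cycs_mnm (map f s).
Proof.
move=> hf; suff: forall m, exists m', forall s,
    m = cycs_mnm s -> m' = cycs_mnm (map f s).
  by case/choice=> w hw; exists w => s; apply: hw.
move=> m; have [[s ->]|nom] := pselect (exists s : seq (Cyc M), m = cycs_mnm s).
  by exists (cycs_mnm (map f s)) => t; apply: preserves_chi_cycs_mnm.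
(* Off the products of generators the value is arbitrary. *)
by exists 0%MM => s ms; case: nom; exists s.
Qed.

Section CycleMorphism.
Variables (K : fieldType) (T T' : finType) (M : matroid T) (M' : matroid T').
Variables (f : Cyc M -> Cyc M').
Variable w : 'X_{1..#|elt M|.+1} -> 'X_{1..#|elt M'|.+1}.
Hypothesis wE : forall s, w (cycs_mnm s) = cycs_mnm (map f s).

Lemma mnm_linear_cycle_alg (p : cycle_algebra K M) :
  mnm_linear w (val p) \in @cycle_alg_pred K T' M'.
Proof.
rewrite /mnm_linear big_seq; apply: rpred_sum => m pm; apply: rpredZ.
have [s ->] := msupp_cycle_alg (valP p) pm.
by rewrite wE mpolyX_cycs_mnm.
Qed.

Definition cycle_map (p : cycle_algebra K M) : cycle_algebra K M' :=
  CycleAlgebra (mnm_linear_cycle_alg p).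

Fact cycle_map_is_linear : linear cycle_map.
Proof. by move=> a p q; apply: val_inj; rewrite /= !linearP. Qed.

Fact cycle_map_is_monoid_morphism : monoid_morphism cycle_map.
Proof.
split=> [|p q]; apply: val_inj => /=.
  (* The unit is the empty product of generators, so the empty list gives [w 0 = 0]. *)
  have := wE [::]; rewrite /cycs_mnm !big_nil => w0.
  by rewrite -!mpolyX0 mnm_linearX w0.
apply: mnm_linearM => m m' pm qm'.
have [s ->] := msupp_cycle_alg (valP p) pm.
have [t ->] := msupp_cycle_alg (valP q) qm'.
by rewrite -cycs_mnm_cat !wE map_cat cycs_mnm_cat.
Qed.

HB.instance Definition _ := GRing.isLinear.Build K (cycle_algebra K M)
  (cycle_algebra K M') _ cycle_map cycle_map_is_linear.
HB.instance Definition _ := GRing.isMonoidMorphism.Build (cycle_algebra K M)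
  (cycle_algebra K M') cycle_map cycle_map_is_monoid_morphism.

(** The shift is 0: applying [f] to each factor keeps the number of factors, which is the exponent
    of [z]. *)
Lemma cycle_map_homogeneous :
  homogeneous_map (@cycle_component K T M) (@cycle_component K T' M') cycle_map.
Proof.
exists 0 => i p hp m /msupp_mnm_linear[m0 pm0 ->].
rewrite addr0 -(hp _ pm0); have [s ->] := msupp_cycle_alg (valP p) pm0.
by rewrite wE !cycs_mnm0 size_map.
Qed.

End CycleMorphism.

Lemma cycle_mapK (K : fieldType) (T T' : finType) (M : matroid T)
    (M' : matroid T') (f : Cyc M -> Cyc M') (g : Cyc M' -> Cyc M) w v
    (wE : forall s, w (cycs_mnm s) = cycs_mnm (map f s))
    (vE : forall s, v (cycs_mnm s) = cycs_mnm (map g s)) :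
  cancel f g -> cancel (@cycle_map K _ _ _ _ f w wE) (cycle_map vE).
Proof.
(* Only the inner map is unfolded; the outer one is distributed by linearity, which reduces the
   claim to monomials in the support of [p]. *)
move=> fK p; apply: val_inj => /=; rewrite [RHS]mpolyE [mnm_linear w _]/mnm_linear linear_sum.
apply: eq_big_seq => m pm; rewrite linearZ /= mnm_linearX.
have [s ->] := msupp_cycle_alg (valP p) pm.
by rewrite wE vE mapK.
Qed.

Theorem theorem4p8 (K : fieldType) (T : finType) (M M' : matroid T)
    (hM : nonfree M) (hM' : nonfree M') (hret : matroidal_retract M' M) :
  @algebra_retract K (cycle_algebra K M') (cycle_algebra K M)
    (@cycle_component K T M') (@cycle_component K T M).
Proof.
have [_ [lambda [pi [lambdaK hlambda hpi]]]] := hret.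
have [w wE] := cycle_mnm_map_exists hlambda.
have [v vE] := cycle_mnm_map_exists hpi.
(* The inclusion is induced by [lambda] and the retraction by [pi]; [lambdaK] makes their composite
   the identity. *)
exists (cycle_map (K := K) wE), (cycle_map (K := K) vE).
by split; [exact: cycle_map_homogeneous | exact: cycle_map_homogeneous
  | exact: cycle_mapK].
Qed.
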